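(* Let $X$ be a compact metric space and $T:X\to X$ continuous, and assume $X$ is zero-dimensional, i.e. for every $\delta>0$ there is a partition of $X$ into closed-open sets each of diameter less than $\delta$. Let $f:X\to\mathbb R$ be continuous. Then for any analytic set $Z\subseteq X$, \[ P_B(T,f,Z)=\sup\{P_B(T,f,K):K\subseteq Z,\ K\text{ compact}\}. \]
   Context: A set is analytic if it is a continuous image of $\mathbb N^{\mathbb N}$ with the product topology. Notation: $d$ metric on $X$; $d_n(x,y)=\max\{d(T^ix,T^iy):0\le i\le n-1\}$, $B_n(x,\epsilon)=\{y:d_n(x,y)<\epsilon\}$, $f_n=\sum_{i=0}^{n-1}f\circ T^i$. Bowen topological pressure: for $\epsilon>0$, $\Gamma=\{B_{n_i}(x_i,\epsilon)\}_i$ (finite or countable) covers $Z$ if $Z\subseteq\bigcup_iB_{n_i}(x_i,\epsilon)$, $n(\Gamma)=\min_in_i$. $M(Z,f,s,N,\epsilon)=\inf_\Gamma\sum_i\exp\big(-sn_i+\sup_{y\in B_{n_i}(x_i,\epsilon)}f_{n_i}(y)\big)$ over covers with $n(\Gamma)\ge N$; $m(Z,f,s,\epsilon)=\lim_NM(Z,f,s,N,\epsilon)$; $P_B(T,f,Z,\epsilon)=\inf\{s:m(Z,f,s,\epsilon)=0\}$; $P_B(T,f,Z)=\lim_{\epsilon\to0}P_B(T,f,Z,\epsilon)$. *)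

(* Defs.v *)
From HB Require Import structures.
From mathcomp Require Import all_boot all_order all_algebra.
From mathcomp Require Import all_classical all_reals all_analysis.
Set Implicit Arguments. Unset Strict Implicit. Unset Printing Implicit Defensive.
Import Order.TTheory GRing.Theory Num.Theory.
Import numFieldTopology.Exports.
Local Open Scope classical_set_scope.
Local Open Scope ring_scope.

Section Bowen.
Context {R : realType} {X : metricType R}.

Definition dn (T : X -> X) (n : nat) (x y : X) : R :=
  \big[Num.max/0]_(i < n) mdist (iter i T x) (iter i T y).

Definition Bball (T : X -> X) (n : nat) (x : X) (eps : R) : set X :=
  [set y | dn T n x y < eps].

Definition birk (f : X -> R) (T : X -> X) (n : nat) (y : X) : R :=
  \sum_(i < n) f (iter i T y).

(* A finite or countable family {B_{n_i}(x_i, eps)}_i : indices i with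
   G i = None are absent from the family. *)
Definition bfamily := nat -> option (X * nat).

Definition fam_ball (T : X -> X) (eps : R) (G : bfamily) (i : nat) : set X :=
  match G i with Some (x, n) => Bball T n x eps | None => set0 end.

Definition fam_covers (T : X -> X) (eps : R) (G : bfamily) (Z : set X) :=
  Z `<=` \bigcup_i fam_ball T eps G i.

Definition fam_ge (G : bfamily) (N : nat) :=
  forall i x n, G i = Some (x, n) -> (N <= n)%N.

Definition fam_term (T : X -> X) (f : X -> R) (s eps : R) (G : bfamily)
  (i : nat) : \bar R :=
  match G i with
  | Some (x, n) =>
      (expR (- (s * n%:R) + sup [set birk f T n y | y in Bball T n x eps]))%:E
  | None => 0%E
  end.

Definition Mcov (T : X -> X) (Z : set X) (f : X -> R) (s : R) (N : nat)
  (eps : R) : \bar R :=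
  ereal_inf [set (\sum_(0 <= i <oo) fam_term T f s eps G i)%E
            | G in [set G | fam_covers T eps G Z /\ fam_ge G N]].

Definition mcov (T : X -> X) (Z : set X) (f : X -> R) (s eps : R) : \bar R :=
  limn (fun N => Mcov T Z f s N eps).

Definition PBeps (T : X -> X) (f : X -> R) (Z : set X) (eps : R) : \bar R :=
  ereal_inf [set s%:E | s in [set s | mcov T Z f s eps = 0%E]].

Definition PB (T : X -> X) (f : X -> R) (Z : set X) : \bar R :=
  lim ((fun eps => PBeps T f Z eps) @ 0^'+).

End Bowen.

Definition diam {R : realType} {X : metricType R} (A : set X) : R :=
  sup [set mdist p.1 p.2 | p in A `*` A].

Definition zero_dim {R : realType} (X : metricType R) : Prop :=
  forall delta : R, 0 < delta ->
  exists P : set (set X),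
    [/\ (forall A, P A -> [/\ A !=set0, open A, closed A & diam A < delta]),
        \bigcup_(A in P) A = [set: X] &
        (forall A B, P A -> P B -> A <> B -> A `&` B = set0)].

Definition baire_space : Type := prod_topology (fun _ : nat => nat).
HB.instance Definition _ := Pointed.on baire_space.
HB.instance Definition _ := Nbhs.on baire_space.
HB.instance Definition _ := Topological.on baire_space.

Definition analytic {R : realType} {X : metricType R} (Z : set X) : Prop :=
  exists g : baire_space -> X, continuous g /\ range g = Z.

(* Main.v *)
(* The inequality >= is monotonicity in Z.  For <=, cut X into finitely many
   clopen pieces of small diameter and label them by integers.  Up to an error
   governed by the oscillation of f, Bowen covers of a set amount to covers by
   cylinders of the resulting itineraries, i.e. to sets of words in [seq nat].
   Two cylinders are nested or disjoint, and this makes the associated content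
   continuous along increasing unions.  Writing Z = g(N^N), one can therefore
   bound the coordinates of N^N one after the other by n 0, n 1, ... while the
   content of the g-image stays above a given c > 0.  Cylinders being open, a
   cover of the compact set K = g {x | forall i, x i <= n i} already covers the
   g-image of {x | forall i < p, x i <= n i} for some p, so K has content at
   least c as well. *)
Require Import Defs.
From HB Require Import structures.
From mathcomp Require Import all_boot all_order all_algebra.
From mathcomp Require Import all_classical all_reals all_analysis.
From mathcomp Require Import lra.
Set Implicit Arguments. Unset Strict Implicit. Unset Printing Implicit Defensive.
Import Order.TTheory GRing.Theory Num.Theory.
Import numFieldTopology.Exports.
Local Open Scope classical_set_scope.
Local Open Scope ring_scope.

(** * Covers by words *)

Section WordCovers.
Context {R : realType} {S : Type} (h : S -> nat -> nat).
Implicit Types (D : set (seq nat)) (A : set S).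

(** A word [u] stands for the cylinder of points whose code under [h] begins with [u]. Any set [D]
    of words is allowed, since [seq nat] is countable. *)
Definition word_cover D A :=
  forall y, A y -> exists2 u, D u & mkseq (h y) (size u) = u.

(** Keeping only the shortest words leaves pairwise disjoint cylinders with the same union. *)
Definition min_words D : set (seq nat) :=
  [set u | D u /\ forall v, D v -> prefix v u -> v = u].

Lemma min_wordsP D u : D u -> exists2 v, min_words D v & prefix v u.
Proof.
move: {2}(size u).+1 (ltnSn (size u)) => n.
elim: n u => // n IH u; rewrite ltnS => un Du.
have [mu|] := pselect (min_words D u); first by exists u; rewrite ?prefix_refl.
move=> /not_andP[//|/existsNP[v /not_implyP[Dv /not_implyP[vu vneu]]]].
have [|//|w mw wv] := IH v.
  rewrite (leq_trans _ un)// ltn_neqAle size_prefix// andbT.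
  apply/eqP => svu; apply: vneu; move: vu; rewrite prefixE svu.
  by rewrite take_size => /eqP.
by exists w => //; exact: prefix_trans vu.
Qed.

Lemma take_mkseq (y : nat -> nat) m n : (m <= n)%N ->
  take m (mkseq y n) = mkseq y m.
Proof. by move=> mn; rewrite /mkseq -map_take take_iota (minn_idPl mn). Qed.

Lemma prefix_mkseq (y : nat -> nat) m n : (m <= n)%N ->
  prefix (mkseq y m) (mkseq y n).
Proof.
by move=> mn; rewrite prefixE size_mkseq take_mkseq// eqxx.
Qed.

Lemma mkseq_prefix (y : nat -> nat) (u v : seq nat) :
  mkseq y (size u) = u -> prefix v u -> mkseq y (size v) = v.
Proof.
move=> yu vu; have := vu; rewrite prefixE -{1}yu take_mkseq ?size_prefix//.
by move/eqP.
Qed.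

Lemma word_cover_min D A : word_cover D A -> word_cover (min_words D) A.
Proof.
move=> DA y /DA[u Du yu]; have [v mv vu] := min_wordsP Du.
by exists v => //; exact: mkseq_prefix yu vu.
Qed.

Context (N : nat) (W : seq nat -> \bar R) (W0 : forall u, (0 <= W u)%E).

Definition long_cover D A := word_cover D A /\ forall u, D u -> (N <= size u)%N.

(** An outer measure of Hausdorff content type: the length bound [N] stays fixed. *)
Definition content A : \bar R :=
  ereal_inf [set (\esum_(u in D) W u)%E | D in [set D | long_cover D A]].

Lemma content_ge0 A : (0 <= content A)%E.
Proof. by apply: le_ereal_inf_tmp => _ [D _ <-]; exact: esum_ge0. Qed.

Lemma content_le D A : long_cover D A -> (content A <= \esum_(u in D) W u)%E.
Proof. by move=> DA; apply: ereal_inf_lbound; exists D. Qed.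

Lemma content_mono A B : A `<=` B -> (content A <= content B)%E.
Proof.
move=> AB; apply: ereal_inf_le_tmp => _ [D [DB sD] <-]; exists D => //.
by split => // y /AB/DB.
Qed.

(** No word is counted more often in [E'] and [R'] together than in [E] and [C] together, so the
    inequality holds word by word. *)
Lemma esum_exchange (E C E' R' : set (seq nat)) :
  E' `<=` E `|` C -> R' `<=` E `|` C -> E' `&` R' `<=` E `&` C ->
  (\esum_(u in E') W u + \esum_(u in R') W u <=
   \esum_(u in E) W u + \esum_(u in C) W u)%E.
Proof.
move=> E'EC R'EC ER.
rewrite (esum_mkcond E') (esum_mkcond R') (esum_mkcond E) (esum_mkcond C).
have if0 (P : set (seq nat)) u : (0 <= if u \in P then W u else 0)%E.
  by case: ifP.
rewrite -!esumD//; apply: le_esum => u _.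
have WW : (W u <= W u + W u)%E by rewrite leeDl.
case: (boolP (u \in E')) => [/set_mem uE'|_];
  case: (boolP (u \in R')) => [/set_mem uR'|_] /=.
- by have [/mem_set -> /mem_set ->] := ER u (conj uE' uR').
- by rewrite adde0; case: (E'EC u uE') => /mem_set ->;
    case: ifP; rewrite ?adde0 ?add0e.
- by rewrite add0e; case: (R'EC u uR') => /mem_set ->;
    case: ifP; rewrite ?adde0 ?add0e.
- by rewrite adde0 adde_ge0.
Qed.

(* Near-optimal covers [C_ k] of [A_ k] are merged into [E k], the shortest
   words of [C_ 0], ..., [C_ k].  The words lost in passing from [E k] and
   [C_ k.+1] to [E k.+1] still cover [A_ k], so they weigh at least
   [content (A_ k)] and the errors [d k] add up to at most [e]. *)
Lemma content_bigcup_le (A_ : nat -> set S) (c : R) :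
  (forall k, A_ k `<=` A_ k.+1) ->
  (forall k, (content (A_ k) <= c%:E)%E) -> (content (\bigcup_k A_ k) <= c%:E)%E.
Proof.
move=> Ainc Ac; apply/lee_addgt0Pr => e e0.
have Afin k : content (A_ k) \is a fin_num.
  by rewrite ge0_fin_numE ?content_ge0// (le_lt_trans (Ac k))// ltry.
pose d k : R := e / 2 ^+ k.+1.
have d0 k : 0 < d k by rewrite divr_gt0// exprn_gt0.
have dS k : d k.+1 + d k.+1 = d k.
  by rewrite /d -mulrDr (exprS _ k.+1) invfM; congr (e * _); lra.
have /choice[C_ HC] k : exists C, long_cover C (A_ k) /\
    (\esum_(u in C) W u < content (A_ k) + (d k)%:E)%E.
  by have [_ [C CA <-] ltC] := lb_ereal_inf_adherent (d0 k) (Afin k); exists C.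
pose U k : set (seq nat) := \bigcup_(i in [set i | (i <= k)%N]) C_ i.
pose E k := min_words (U k).
have Ecov k : word_cover (E k) (A_ k).
  apply: word_cover_min => y /(HC k).1.1[u Cu yu].
  by exists u => //; exists k => /=.
have US k u : U k.+1 u -> U k u \/ C_ k.+1 u.
  move=> [i /=]; rewrite leq_eqVlt => /orP[/eqP ->|ik] Ci; first by right.
  by left; exists i.
have Usub k l u : (k <= l)%N -> U k u -> U l u.
  by move=> kl [i /= ik Ciu]; exists i => //=; exact: leq_trans ik kl.
have ES k u : E k.+1 u -> E k u \/ C_ k.+1 u.
  move=> [/US[Uu|Cu] mu]; last by right.
  by left; split => // v Uv; apply: mu; exact: Usub Uv.
have Esize k u : U k u -> (N <= size u)%N.
  by move=> [i _]; exact: (HC i).1.2.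
(* The error [e - d k] is the sum of [d 0], ..., [d k]. *)
have Ele k : (\esum_(u in E k) W u <= content (A_ k) + (e - d k)%:E)%E.
  elim: k => [|k IH].
    have -> : e - d 0 = d 0.
      by rewrite /d expr1 [X in X - _](splitr e) addrK.
    apply: le_trans (ltW (HC 0%N).2).
    rewrite (esum_mkcond (E 0%N)) (esum_mkcond (C_ 0%N)); apply: le_esum => u _.
    case: ifP => [/set_mem [[i /=]]|_]; last by case: ifP.
    by rewrite leqn0 => /eqP -> /mem_set ->.
  pose R' := ((E k `|` C_ k.+1) `\` E k.+1) `|` (E k `&` C_ k.+1).
  have R'cov : long_cover R' (A_ k).
    split => [y Ay|u [[[[Uu _]|Cu] _]|[[Uu _] _]]]; last 3 first.
    - exact: Esize Uu.
    - exact: (HC k.+1).1.2 Cu.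
    - exact: Esize Uu.
    have [u Eu yu] := Ecov k y Ay.
    have [v Cv yv] := (HC k.+1).1.1 _ (Ainc _ _ Ay).
    have Uv : U k.+1 v by exists k.+1 => /=.
    have Uu : U k.+1 u by case: Eu => Uu _; exact: Usub Uu.
    (* Both [u] and [v] begin the code of [y], so they are nested. If they differ, the longer one is
       not minimal in [U k.+1] and lies in [R']; if they agree, the word lies in [E k] and in
       [C_ k.+1]. *)
    have [uv|uv] := eqVneq u v.
      by exists u => //; right; split => //; rewrite uv.
    have [suv|/ltnW svu] := leqP (size u) (size v).
      exists v => //; left; split; first by right.
      move=> [_ /(_ u Uu)]; rewrite -{1}yu -{1}yv => /(_ (prefix_mkseq (h y) suv)).
      by move/eqP; rewrite (negbTE uv).
    exists u => //; left; split; first by left.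
    move=> [_ /(_ v Uv)]; rewrite -{1}yu -{1}yv => /(_ (prefix_mkseq (h y) svu)).
    by move/esym/eqP; rewrite (negbTE uv).
  have R'sub : R' `<=` E k `|` C_ k.+1.
    by move=> u [[//]|[]]; left.
  have ER' : E k.+1 `&` R' `<=` E k `&` C_ k.+1.
    by move=> u [Eu [[_ /(_ Eu)]|]].
  have ex := esum_exchange (ES k) R'sub ER'.
  have := leeD IH (ltW (HC k.+1).2).
  move=> /(le_trans ex) le1.
  have := le_trans (leeD2l (\esum_(u in E k.+1) W u)%E (content_le R'cov)) le1.
  rewrite -(fineK (Afin k)) -(fineK (Afin k.+1)) -!EFinD.
  rewrite -leeBrDr// => /le_trans; apply; rewrite -EFinB lee_fin.
  rewrite -(dS k); lra.
pose Einf := min_words (\bigcup_i C_ i).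
apply: (@le_trans _ _ (\esum_(u in Einf) W u)%E).
  apply: content_le; split.
    apply: word_cover_min => y [k _ /(HC k).1.1[u Cu yu]].
    by exists u => //; exists k.
  by move=> u [[k _ Cu] _]; exact: (HC k).1.2 Cu.
apply: ge_ereal_sup => _ [F [finF FE] <-].
(* A finite [F] meets finitely many of the covers, and a word minimal among all covers is minimal in
   each [U k] containing it. *)
have [k FEk] : exists k, F `<=` E k.
  have /choice[ix Hix] (u : seq nat) : exists i, F u -> C_ i u.
    have [/FE[[i _ Ci] _]|] := pselect (F u); first by exists i.
    by exists 0%N.
  have /finite_seqP[s Fs] := finF.
  exists (\max_(u <- s) ix u)%N => u Fu; split.
    exists (ix u); last exact: Hix.
    by apply: leq_bigmax_seq => //; move: Fu; rewrite Fs.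
  by move=> v [i _ Cv] vu; apply: (FE u Fu).2 => //; exists i.
apply: (@le_trans _ _ (\esum_(u in E k) W u)%E).
  by apply: esum_ge; exists F.
apply: (le_trans (Ele k)); apply: leeD => //; rewrite lee_fin.
by rewrite lerBlDr lerDl ltW.
Qed.

End WordCovers.

(** * Compact boxes in Baire space *)

Section BaireCapacity.

Lemma near_forall_ltn {X : topologicalType} (x : X) (P : nat -> X -> Prop) q :
  (forall i, (i < q)%N -> \forall y \near x, P i y) ->
  \forall y \near x, forall i, (i < q)%N -> P i y.
Proof.
elim: q => [_|q IH Pq]; first by apply: nearW => y i.
have := IH (fun i iq => Pq i (leqW iq)); apply: filterS2 (Pq q (ltnSn q)) => y Pqy H i.
by rewrite ltnS leq_eqVlt => /orP[/eqP ->|/H].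
Qed.

Lemma baire_cylinder_nbhs (x : baire_space) q :
  \forall y \near x, forall i, (i < q)%N -> y i = x i.
Proof.
apply: near_forall_ltn => i _.
have : nbhs (x i) [set k | k = x i].
  by rewrite nbhs_principalE; apply/principal_filterP.
exact: (@proj_continuous nat (fun=> nat) i x).
Qed.

(** The cylinders around [x] generate a filter. Its convergence to [x] is tested one coordinate at a
    time, and the cylinder of length [i.+1] fixes coordinate [i]. *)
Lemma baire_nbhs_cylinder (x : baire_space) (V : set baire_space) : nbhs x V ->
  exists q, forall y : baire_space, (forall i, (i < q)%N -> y i = x i) -> V y.
Proof.
pose C q := [set y : baire_space | forall i, (i < q)%N -> y i = x i].
pose F := filter_from [set: nat] C.
have FF : Filter F.
  apply: filter_from_filter; first by exists 0%N.
  move=> p q _ _; exists (maxn p q) => // y Cy; split => i il; apply: Cy.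
    by rewrite leq_max il.
  by rewrite leq_max il orbT.
suff Fx : F --> x by move=> /Fx[q _ CV]; exists q => y; exact: CV.
apply/cvg_sup => i; apply/cvg_image.
  apply/seteqP; split => // k _; exists (@dfwith nat (fun=> nat) x i k); rewrite ?dfwithin.
move=> B; rewrite nbhs_principalE => /principal_filterP Bxi.
exists ((fun y : baire_space => y i) @^-1` B).
  by exists i.+1 => // y Cy /=; rewrite Cy.
apply/seteqP; split => [_ [y By <-]//|k Bk].
by exists (@dfwith nat (fun=> nat) x i k); rewrite /= dfwithin.
Qed.

Lemma compact_baire_box (n : nat -> nat) :
  compact [set x : baire_space | forall i, (x i <= n i)%N].
Proof.
apply: (@tychonoff nat (fun=> nat) (fun i => [set k | (k <= n i)%N])) => i.
by apply: finite_compact; apply: (sub_finite_set _ (finite_II (n i).+1)) => k.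
Qed.

Context {R : realType} (h : baire_space -> nat -> nat) (N : nat).
Context (W : seq nat -> \bar R) (W0 : forall u, (0 <= W u)%E).
Context (hloc : forall x i, \forall y \near x, h y i = h x i).

(** Lying in the cylinder of [u] depends on finitely many letters of the code, each locally
    constant. *)
Lemma word_cover_nbhs D (x : baire_space) u : D u -> mkseq (h x) (size u) = u ->
  \forall y \near x, exists2 v, D v & mkseq (h y) (size v) = v.
Proof.
move=> Du xu; have := @near_forall_ltn _ x _ (size u) (fun i _ => hloc x i).
apply: filterS => y yx; exists u => //; rewrite -[RHS]xu.
by apply/eq_in_map => i; rewrite mem_iota add0n; exact: yx.
Qed.

(** Compactness of the box gives one [p] such that every point sharing its first [p] coordinates
    with a point of the box is covered. *)
Lemma word_cover_box D (n : nat -> nat) :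
  word_cover h D [set x | forall i, (x i <= n i)%N] ->
  exists p, word_cover h D [set x | forall i, (i < p)%N -> (x i <= n i)%N].
Proof.
move=> Dn; pose V x := exists2 u, D u & mkseq (h x) (size u) = u.
have /compact_near_coveringP Kcov := @compact_baire_box n.
have := Kcov nat \oo (fun p x => forall y : baire_space,
  (forall i, (i < p)%N -> y i = x i) -> V y) _.
case.
  move=> x /Dn[u Du xu].
  have [q qV] := baire_nbhs_cylinder (word_cover_nbhs Du xu).
  exists ([set y : baire_space | forall i, (i < q)%N -> y i = x i],
          [set p | (q <= p)%N]).
    by split => /=; [exact: baire_cylinder_nbhs|exists q].
  move=> [z p] [/= zx qp] y yz; apply: qV => i iq.
  by rewrite yz ?zx// (leq_trans iq).
move=> p _ /(_ p (leqnn p)) Hp; exists p => x xn.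
(* Truncating [x] gives a point of the box that agrees with [x] on the first [p] coordinates. *)
apply: (Hp (fun i => minn (x i) (n i))) => i /=; first exact: geq_minr.
by move=> ip; rewrite (minn_idPl (xn i ip)).
Qed.

Lemma content_box (c : R) : (c%:E < content h N W [set: baire_space])%E ->
  exists n : nat -> nat,
    (c%:E <= content h N W [set x : baire_space | forall i, (x i <= n i)%N])%E.
Proof.
move=> cT.
pose B s : set baire_space :=
  [set x | forall i, (i < size s)%N -> (x i <= nth 0 s i)%N].
have /choice[k Hk] s : exists k,
    (c%:E < content h N W (B s) -> c%:E < content h N W (B (rcons s k)))%E.
  apply: contrapT => /forallNP Hs.
  have [cB|cB] := pselect (c%:E < content h N W (B s))%E; last first.
    by apply: (Hs 0%N) => /cB.
  move: cB; apply/negP; rewrite -leNgt.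
  (* [B s] is the increasing union of the sets [B (rcons s k)]: if none of these had content above
     [c], neither would [B s]. *)
  have Ble : (content h N W (\bigcup_k B (rcons s k)) <= c%:E)%E.
    apply: content_bigcup_le => // k.
      move=> x Bx i; rewrite size_rcons => isk; have := Bx i.
      rewrite size_rcons !nth_rcons => /(_ isk).
      by case: ifP => // _; case: ifP => // _ /leq_trans; apply.
    by rewrite leNgt; apply/negP => lt; apply: (Hs k) => _.
  apply: le_trans Ble; apply: content_mono => x Bx.
  exists (x (size s)) => // i; rewrite size_rcons nth_rcons ltnS leq_eqVlt.
  move=> /orP[/eqP ->|/[dup] iss -> /=]; first by rewrite ltnn eqxx.
  exact: Bx.
pose fix s p := if p is p'.+1 then rcons (s p') (k (s p')) else [::].
have ss p : size (s p) = p by elim: p => //= p IH; rewrite size_rcons IH.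
have cs p : (c%:E < content h N W (B (s p)))%E.
  elim: p => [|p IH]; last exact: Hk.
  by apply: (lt_le_trans cT); apply: content_mono.
have sE p i : (i < p)%N -> nth 0%N (s p) i = k (s i).
  elim: p => // p IH; rewrite ltnS /= nth_rcons ss leq_eqVlt.
  by move=> /orP[/eqP ->|/[dup] ip ->]; [rewrite ltnn eqxx|exact: IH].
exists (fun i => k (s i)); apply: le_ereal_inf_tmp => _ [D [Dn sD] <-].
have [p Dp] := word_cover_box Dn.
apply: le_trans (ltW (cs p)) _; apply: content_le; split => // x Bx.
by apply: Dp => i ip; have := Bx i; rewrite ss sE//; exact.
Qed.

End BaireCapacity.

(** * Compact metric spaces *)

Section CompactMetric.
Context {R : realType} {X : metricType R}.
Context (Xcpt : compact [set: X]).

Lemma nbhs_mdist (x : X) (r : R) : 0 < r -> \forall y \near x, mdist x y < r.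
Proof. by move=> r0; apply/metricType_numDomainType.nbhs_mdistP; exists r. Qed.

(** Lebesgue's number lemma for an arbitrary relation, used for the oscillation of [f] and for the
    local constancy of labels. *)
Lemma lebesgue_number (Q : X -> X -> Prop) :
  (forall x : X, exists2 A, nbhs x A & forall y z, A y -> A z -> Q y z) ->
  exists2 e : R, 0 < e & forall y z, mdist y z < e -> Q y z.
Proof.
move=> locQ; have /compact_near_coveringP Xcov := Xcpt.
have := Xcov R 0^'+ (fun e y => forall z, mdist y z < e -> Q y z) _.
case.
  move=> x _; have [A /metricType_numDomainType.nbhs_mdistP[r r0 rA] AQ] := locQ x.
  exists ([set y | mdist x y < r / 2], [set e | e < r / 2]).
    by split => /=; [apply: nbhs_mdist|apply: nbhs_right_lt]; rewrite divr_gt0.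
  move=> [y e] /= [xy er] z yz; apply: AQ; apply: rA => /=.
    by rewrite (lt_trans xy)// ltr_pdivrMr// ltr_pMr// ltr1n.
  apply: (le_lt_trans (metric_triangle _ y _)).
  by rewrite (splitr r) ltrD// (lt_trans yz).
move=> e e0 He; exists (e / 2); first by rewrite divr_gt0.
move=> y z yz; apply: (He (e / 2)) => //=.
  by rewrite sub0r normrN gtr0_norm ?divr_gt0// ltr_pdivrMr// ltr_pMr// ltr1n.
by rewrite divr_gt0.
Qed.

(** As [sup] takes a default value on unbounded sets, such a bound is what lets [diam A < d] control
    distances in [A]. *)
Lemma mdist_bounded : exists M : R, forall y z : X, mdist y z <= M.
Proof.
have [[x0]|noX] := pselect (inhabited X); last first.
  by exists 0 => y; exfalso; apply: noX.
have /compact_near_coveringP Xcov := Xcpt.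
have := Xcov R +oo (fun M y => mdist x0 y < M) _.
case.
  move=> x _; exists ([set y | mdist x y < 1], [set M | mdist x0 x + 1 < M]).
    split => /=; first exact: nbhs_mdist.
    by exists (mdist x0 x + 1); split; rewrite ?num_real.
  move=> [y M] /= [xy]; apply: le_lt_trans.
  by apply: (le_trans (metric_triangle _ x _)); rewrite lerD2l ltW.
move=> M [_ HM]; exists ((M + 1) + (M + 1)) => y z.
have M1 : M < M + 1 by rewrite ltrDl.
apply: (le_trans (metric_triangle _ x0 _)).
by rewrite lerD// ltW//; [rewrite metric_sym|]; apply: (HM (M + 1)).
Qed.

Lemma mdist_lt_diam (A : set X) (d : R) (y z : X) :
  diam A < d -> A y -> A z -> mdist y z < d.
Proof.
move=> Ad Ay Az; apply: le_lt_trans Ad; apply: ub_le_sup; last first.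
  by exists (y, z).
have [M HM] := mdist_bounded.
by exists M => _ [[a b] _ <-]; exact: HM.
Qed.

(** Compactness extracts from the partition a finite list of pieces covering [X]; a point is
    labelled by the position of its piece in the list. *)
Lemma zero_dim_label (d : R) : zero_dim X -> 0 < d ->
  exists l : X -> nat, (forall y z, l y = l z -> mdist y z < d) /\
    forall x : X, exists2 A, nbhs x A & forall y z, A y -> A z -> l y = l z.
Proof.
move=> zX d0; have [P [PA Pcov Pdisj]] := zX d d0.
have /compact_near_coveringP Xcov := Xcpt.
pose isP (L : seq (set X)) := forall A, A \in L -> P A.
pose above (L : seq (set X)) : set (seq (set X)) := [set L' | {subset L <= L'} /\ isP L'].
(* Finite lists of pieces are directed by inclusion; near-covering along this filter yields the
   finite subcover. *)
pose F := filter_from isP above.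
have FF : Filter F.
  apply: filter_from_filter; first by exists [::].
  move=> L L' PL PL'; exists (L ++ L').
    by move=> A; rewrite mem_cat => /orP[/PL|/PL'].
  move=> M [LM PM]; split; split => // A AL; apply: LM; rewrite mem_cat AL//.
  by rewrite orbT.
have := Xcov _ F (fun L x => exists2 A, A \in L & A x) FF.
case.
  move=> x _; have : (\bigcup_(A in P) A) x by rewrite Pcov.
  move=> [A AP Ax]; have [_ oA _ _] := PA A AP.
  exists (A, above [:: A]).
    split => /=; first exact: open_nbhs_nbhs.
    by exists [:: A] => // B; rewrite inE => /eqP ->.
  move=> [y L] /= [Ay [AL _]]; exists A => //; apply: AL; exact: mem_head.
move=> L0 PL0 HL0.
pose l x := find (fun A => `[< A x >]) L0.
have L0cov x := HL0 L0 (conj (fun A => id) PL0) x I.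
have hasl x : has (fun A => `[< A x >]) L0.
  by apply/hasP; have [A AL Ax] := L0cov x; exists A => //; apply/asboolP.
exists l; split.
  move=> y z lyz; set A := nth set0 L0 (l y).
  have AL : A \in L0 by rewrite mem_nth// -has_find.
  have [_ _ _ dA] := PA _ (PL0 _ AL).
  apply: (mdist_lt_diam dA).
    by have /asboolP := nth_find set0 (hasl y).
  by have /asboolP := nth_find set0 (hasl z); rewrite -/(l z) -lyz.
move=> x; have [A AL Ax] := L0cov x; have [_ oA _ _] := PA _ (PL0 _ AL).
exists A => [|y z Ay Az]; first exact: open_nbhs_nbhs.
apply: eq_in_find => B BL.
(* By disjointness [A] is the only piece of the list containing a point of [A], so [find] stops at
   the same place for all of them. *)
have only w : A w -> `[< B w >] = `[< B = A >].
  move=> Aw; apply/asboolP/asboolP => [Bw|->//].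
  apply: contrapT => BA.
  by have := Pdisj _ _ (PL0 _ BL) (PL0 _ AL) BA; rewrite -subset0 => /(_ w); apply.
by rewrite !only.
Qed.

Lemma uniform_osc (f : X -> R) (eta : R) : continuous f -> 0 < eta ->
  exists2 e : R, 0 < e & forall y z, mdist y z < e -> `|f y - f z| <= eta.
Proof.
move=> fcont eta0; apply: lebesgue_number => x.
have eta20 : 0 < eta / 2 by rewrite divr_gt0.
have fx : \forall y \near x, `|f x - f y| < eta / 2.
  by have /cvgrPdist_lt := fcont x; exact.
exists [set y | `|f x - f y| < eta / 2] => // y z /= xy xz; rewrite -(subrKA (f x)) (splitr eta).
by rewrite (le_trans (ler_normD _ _))// lerD// ltW// distrC.
Qed.

End CompactMetric.

(** * Bowen pressure at a fixed scale *)

Section BowenPressure.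
Context {R : realType} {X : metricType R} (T : X -> X) (f : X -> R).

Lemma BballP n x (e : R) y : 0 < e ->
  Bball T n x e y <-> forall i, (i < n)%N -> mdist (iter i T x) (iter i T y) < e.
Proof.
move=> e0; split => [/bigmax_ltP[_ H] i ni|H]; first exact: (H (Ordinal ni)).
by apply/bigmax_ltP; split => // i _; exact: H.
Qed.

Lemma fam_term_ge0 s e G i : (0 <= fam_term T f s e G i)%E.
Proof. by rewrite /fam_term; case: (G i) => [[x n]|]//; rewrite lee_fin expR_ge0. Qed.

Lemma Mcov_ge0 Z s N e : (0 <= Mcov T Z f s N e)%E.
Proof.
apply: le_ereal_inf_tmp => _ [G _ <-]; apply: nneseries_ge0 => i _ _.
exact: fam_term_ge0.
Qed.

Lemma mcov_cvg Z s e :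
  Mcov T Z f s N e @[N --> \oo] --> ereal_sup (range (fun N => Mcov T Z f s N e)).
Proof.
apply: ereal_nondecreasing_cvgn => m n mn; apply: ereal_inf_le_tmp.
move=> _ [G [GZ Gn] <-]; exists G => //; split => // i x k Gi.
exact: leq_trans mn (Gn i x k Gi).
Qed.

Lemma Mcov_le_mcov Z s N e : (Mcov T Z f s N e <= mcov T Z f s e)%E.
Proof.
by rewrite /mcov (cvg_lim _ (@mcov_cvg Z s e))//; apply: ereal_sup_ubound; exists N.
Qed.

Lemma mcov_le Z s e (c : \bar R) :
  (forall N, Mcov T Z f s N e <= c)%E -> (mcov T Z f s e <= c)%E.
Proof.
move=> Hc; rewrite /mcov (cvg_lim _ (@mcov_cvg Z s e))//.
by apply: ge_ereal_sup => _ [N _ <-].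
Qed.

Lemma mcov_eq0P Z s e :
  mcov T Z f s e = 0%E <-> forall N, (Mcov T Z f s N e <= 0)%E.
Proof.
split=> [m0 N|H]; first by rewrite -m0 Mcov_le_mcov.
by apply/eqP; rewrite eq_le mcov_le//= (le_trans _ (Mcov_le_mcov Z s 0%N e))// Mcov_ge0.
Qed.

(** The same centres and lengths are reused, so comparing sets, exponents or radii reduces to an
    inclusion of balls and an inequality of costs. *)
Lemma Mcov_le_fam (Z Z' : set X) s s' N (e e' : R) : Z' `<=` Z ->
  (forall x n y, Bball T n x e y -> Bball T n x e' y) ->
  (forall x n, - (s' * n%:R) + sup [set birk f T n y | y in Bball T n x e'] <=
               - (s * n%:R) + sup [set birk f T n y | y in Bball T n x e]) ->
  (Mcov T Z' f s' N e' <= Mcov T Z f s N e)%E.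
Proof.
move=> ZZ' ee' cost; apply: le_ereal_inf_tmp => _ [G [GZ GN] <-].
apply: ge_ereal_inf; exists (\sum_(0 <= i <oo) fam_term T f s' e' G i)%E.
  exists G => //; split => // z /ZZ'/GZ[i _]; rewrite /fam_ball => Gz.
  by exists i => //; rewrite /fam_ball; case: (G i) Gz => [[x n]|//]; exact: ee'.
apply: lee_nneseries => i _; first by move=> _; exact: fam_term_ge0.
rewrite /fam_term; case: (G i) => [[x n]|]//.
by rewrite lee_fin ler_expR.
Qed.

Lemma Mcov_subset Z Z' s N e : Z' `<=` Z -> (Mcov T Z' f s N e <= Mcov T Z f s N e)%E.
Proof. by move=> ZZ'; apply: Mcov_le_fam. Qed.

Lemma Mcov_antitone Z s s' N e : s <= s' -> (Mcov T Z f s' N e <= Mcov T Z f s N e)%E.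
Proof.
by move=> ss'; apply: Mcov_le_fam => // x n; rewrite lerD2r lerN2 ler_wpM2r.
Qed.

Section Oscillation.
Context (eta e0 : R).
Context (osc : forall y z, mdist y z < e0 -> `|f y - f z| <= eta).

Lemma birk_osc n x y : (forall i, (i < n)%N -> mdist (iter i T x) (iter i T y) < e0) ->
  birk f T n y <= birk f T n x + n%:R * eta.
Proof.
move=> xy; rewrite mulr_natl -[X in _ <= _ + X](_ : \sum_(i < n) eta = _); last first.
  by rewrite sumr_const card_ord.
rewrite -big_split /=; apply: ler_sum => i _; rewrite -lerBlDl.
by have := osc (xy i (ltn_ord i)); rewrite distrC; apply: le_trans; exact: ler_norm.
Qed.

Lemma sup_birk_le n x e : 0 < e -> e <= e0 ->
  sup [set birk f T n y | y in Bball T n x e] <= birk f T n x + n%:R * eta.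
Proof.
move=> epos ee0; apply: ge_sup.
  by exists (birk f T n x); exists x => //; apply/BballP => // i _; rewrite mdistxx.
move=> _ [y /(BballP _ _ _ epos) xy <-]; apply: birk_osc => i ni.
exact: lt_le_trans (xy i ni) ee0.
Qed.

(** The oscillation bound keeps the Birkhoff sums bounded above on the ball, so that [sup] is a true
    supremum. *)
Lemma birk_le_sup n x e y : 0 < e -> e <= e0 -> Bball T n x e y ->
  birk f T n y <= sup [set birk f T n y | y in Bball T n x e].
Proof.
move=> epos ee0 xy; apply: ub_le_sup; last by exists y.
exists (birk f T n x + n%:R * eta) => _ [z /(BballP _ _ _ epos) xz <-].
by apply: birk_osc => i ni; exact: lt_le_trans (xz i ni) ee0.
Qed.

Lemma birk_le_sup_center n x e : 0 < e -> e <= e0 ->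
  birk f T n x <= sup [set birk f T n y | y in Bball T n x e].
Proof.
by move=> epos ee0; apply: birk_le_sup => //; apply/BballP => // i _; rewrite mdistxx.
Qed.

(** Enlarging the radius raises each supremum by at most [n%:R * eta], which the exponent [s + eta]
    absorbs. *)
Lemma Mcov_radius Z s N e e' : 0 < e' -> e' <= e -> e <= e0 ->
  (Mcov T Z f (s + eta) N e <= Mcov T Z f s N e')%E.
Proof.
move=> e'0 e'e ee0; have epos := lt_le_trans e'0 e'e.
apply: Mcov_le_fam => // [x n y /(BballP _ _ _ e'0) xy|x n].
  by apply/BballP => // i ni; exact: lt_le_trans (xy i ni) e'e.
have := @sup_birk_le n x e epos ee0.
have := @birk_le_sup_center n x e' e'0 (le_trans e'e ee0).
rewrite mulrDl [eta * _]mulrC; lra.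
Qed.

Lemma PBeps_radius Z e e' : 0 < e' -> e' <= e -> e <= e0 ->
  (PBeps T f Z e <= PBeps T f Z e' + eta%:E)%E.
Proof.
move=> e'0 e'e ee0; rewrite -leeBlDr//; apply: le_ereal_inf_tmp => _ [s s0 <-].
have n0 : mcov T Z f (s + eta) e = 0%E.
  apply/mcov_eq0P => N; apply: le_trans (Mcov_radius Z s N e'0 e'e ee0) _.
  by move: (s0 : mcov T Z f s e' = 0%E) => <-; exact: Mcov_le_mcov.
have -> : (s%:E = (s + eta)%:E - eta%:E)%E by rewrite -EFinB addrK.
apply: leeB => //; apply: ereal_inf_lbound.
exists (s + eta); [exact: n0|by []].
Qed.

End Oscillation.

Lemma PBeps_subset Z Z' e : Z' `<=` Z -> (PBeps T f Z' e <= PBeps T f Z e)%E.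
Proof.
move=> ZZ'; apply: ereal_inf_le_tmp => _ [s /= s0 <-]; exists s => //=.
by apply/mcov_eq0P => N; rewrite (le_trans (Mcov_subset _ _ _ ZZ'))// -s0 Mcov_le_mcov.
Qed.

(** [Mcov] is nonincreasing in the exponent, so positivity at [s] excludes every smaller exponent.
    With [PBeps_gt], bounds on the pressure become positivity at a single [N]. *)
Lemma PBeps_ge Z s N e : (0 < Mcov T Z f s N e)%E -> (s%:E <= PBeps T f Z e)%E.
Proof.
move=> M0; apply: le_ereal_inf_tmp => _ [t /= t0 <-]; rewrite lee_fin leNgt.
apply/negP => /ltW ts; move: M0; apply/negP; rewrite -leNgt.
by rewrite (le_trans (Mcov_antitone _ _ _ ts))// -t0 Mcov_le_mcov.
Qed.

Lemma PBeps_gt Z s e : (s%:E < PBeps T f Z e)%E -> exists N, (0 < Mcov T Z f s N e)%E.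
Proof.
move=> sP; apply: contrapT => /forallNP H.
move: sP; apply/negP; rewrite -leNgt; apply: ereal_inf_lbound; exists s => //=.
by apply/mcov_eq0P => N; rewrite leNgt; apply/negP.
Qed.

End BowenPressure.

(* [PBeps] is not monotone in the radius, since shrinking the balls also lowers
   the suprema of the Birkhoff sums; this is the monotonicity that survives. *)
Lemma almost_monotone_cvg {R : realType} (h : R -> \bar R) :
  (forall eta : R, 0 < eta -> exists2 e : R, 0 < e &
    forall x y, 0 < x -> x <= y -> y <= e -> (h y <= h x + eta%:E)%E) ->
  cvg (h x @[x --> 0^'+]).
Proof.
move=> Hh.
(* [H] and [I] are monotone; their limits at 0, called [A] and [B] below, are the upper and lower
   limits of [h]. *)
pose H x := ereal_sup [set h y | y in [set y | 0 < y <= x]].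
pose I x := ereal_inf [set h y | y in [set y | 0 < y <= x]].
have Hmono : {in Interval (BRight (0:R)) (BLeft 1) &, {homo H : n m / n <= m >-> (n <= m)%E}}.
  move=> x y _ _ xy; apply: ereal_sup_le => _ [z /= /andP[z0 zx] <-].
  by exists z => //=; rewrite z0 (le_trans zx).
have Imono : {in Interval (BRight (0:R)) (BLeft 1) &, {homo I : n m / n <= m >-> (m <= n)%E}}.
  move=> x y _ _ xy; apply: ereal_inf_le_tmp => _ [z /= /andP[z0 zx] <-].
  by exists z => //=; rewrite z0 (le_trans zx).
have b01 : (BRight (0:R) < BLeft 1)%O by rewrite bnd_simp.
have Hcvg := nondecreasing_at_right_cvge _ b01 Hmono.
have Icvg := nonincreasing_at_right_cvge _ b01 Imono.
set A := ereal_inf _ in Hcvg; set B := ereal_sup _ in Icvg.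
have Ih x : 0 < x -> (I x <= h x)%E.
  by move=> x0; apply: ereal_inf_lbound; exists x => //=; rewrite x0 lexx.
have hH x : 0 < x -> (h x <= H x)%E.
  by move=> x0; apply: ereal_sup_ubound; exists x => //=; rewrite x0 lexx.
have IhH : \forall x \near 0^'+, (I x <= h x <= H x)%E.
  near=> x; have x0 : 0 < x by near: x; exact: nbhs_right_gt.
  by rewrite Ih// hH.
have BA : (B <= A)%E.
  rewrite -(cvg_lim _ Hcvg)// -(cvg_lim _ Icvg)//; apply: lee_lim.
  - by apply/cvg_ex; exists B.
  - by apply/cvg_ex; exists A.
  - by apply: filterS IhH => x /andP[]; exact: le_trans.
have AB : (A <= B)%E.
  apply/lee_addgt0Pr => eta eta0; have [e e0 He] := Hh _ eta0.
  (* The bound [1 / 2] keeps [r] in the open unit interval over which [A] and [B] are taken. *)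
  pose r := Num.min e (1 / 2).
  have r0 : 0 < r by rewrite lt_min e0 divr_gt0.
  have rin y : 0 < y -> y <= r -> y \in Interval (BRight 0) (BLeft 1).
    move=> y0 yr; rewrite in_itv/= y0 (le_lt_trans yr)// (@le_lt_trans _ _ (1 / 2))//.
      by rewrite ge_min lexx orbT.
    by rewrite ltr_pdivrMr// mul1r ltr1n.
  apply: (@le_trans _ _ (H r)).
    by apply: ereal_inf_lbound; exists r => //=; exact: rin.
  apply: ge_ereal_sup => _ [y /= /andP[y0 yr] <-].
  rewrite -leeBlDr//; apply: (@le_trans _ _ (I y)); last first.
    by apply: ereal_sup_ubound; exists y => //=; exact: rin.
  apply: le_ereal_inf_tmp => _ [x xI <-].
  have [x0 xy] := andP (xI : 0 < x <= y).
  by rewrite leeBlDr// He// (le_trans yr)// ge_min lexx.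
have ABe : B = A by apply/eqP; rewrite eq_le AB BA.
rewrite ABe in Icvg; apply/cvg_ex; exists A.
exact: squeeze_cvge IhH _ Icvg Hcvg.
Unshelve. all: by end_near. Qed.

(** * Itineraries *)

Section Itineraries.
Context {R : realType} {X : metricType R} (T : X -> X) (f : X -> R).
Context (l : X -> nat) (x0 : X).

Definition itinerary (x : X) (i : nat) : nat := l (iter i T x).

(* [cylinder_point u] is [x0] when the cylinder of [u] is empty. *)
Definition cylinder_point (u : seq nat) : X :=
  xget x0 [set y | mkseq (itinerary y) (size u) = u].

(** The cost of a ball, with the supremum replaced by the Birkhoff sum at one point of the
    cylinder. *)
Definition word_weight (s : R) (u : seq nat) : \bar R :=
  (expR (- (s * (size u)%:R) + birk f T (size u) (cylinder_point u)))%:E.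

Lemma word_weight_ge0 s u : (0 <= word_weight s u)%E.
Proof. by rewrite lee_fin expR_ge0. Qed.

Lemma cylinder_pointP y u : mkseq (itinerary y) (size u) = u ->
  forall i, (i < size u)%N -> l (iter i T (cylinder_point u)) = l (iter i T y).
Proof.
move=> yu i iu; have /= pu : [set z | mkseq (itinerary z) (size u) = u] (cylinder_point u).
  by apply: xgetPex; exists y.
have : nth 0%N (mkseq (itinerary (cylinder_point u)) (size u)) i =
       nth 0%N (mkseq (itinerary y) (size u)) i by rewrite pu yu.
by rewrite !nth_mkseq.
Qed.

Context (eta e0 : R).
Context (osc : forall y z, mdist y z < e0 -> `|f y - f z| <= eta).

(** Points with equal labels are [e]-close, so a nonempty cylinder lies in the ball around its
    chosen point. *)
Lemma Mcov_le_content Z s N e : 0 < e -> e <= e0 ->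
  (forall y z, l y = l z -> mdist y z < e) ->
  (Mcov T Z f (s + eta) N e <= content itinerary N (word_weight s) Z)%E.
Proof.
move=> epos ee0 le; apply: le_ereal_inf_tmp => _ [D [DZ DN] <-].
(* Words are listed by their [pickle] codes; other indices stay empty. *)
pose G i : option (X * nat) := if (pickle_inv i : option (seq nat)) is Some u then
  if `[< D u >] then Some (cylinder_point u, size u) else None else None.
have Gu u : D u -> G (pickle u) = Some (cylinder_point u, size u).
  by move=> Du; rewrite /G pickleK_inv; case: asboolP.
apply: ge_ereal_inf; exists (\sum_(0 <= i <oo) fam_term T f (s + eta) e G i)%E.
  exists G => //; split => [z /DZ[u Du zu]|i x n].
    exists (pickle u) => //; rewrite /fam_ball Gu//.
    by apply/BballP => // i iu; apply: le; exact: cylinder_pointP.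
  rewrite /G; case: pickle_inv => // u; case: asboolP => // Du [_ <-].
  exact: DN.
rewrite nneseries_esumT; last by move=> i; exact: fam_term_ge0.
have -> : (\esum_(i in [set: nat]) fam_term T f (s + eta) e G i =
  \esum_(i in pickle @` D) fam_term T f (s + eta) e G i)%E.
  rewrite [RHS]esum_mkcond; apply: eq_esum => i _; case: ifPn => // /negP iD.
  rewrite /fam_term /G; case E : (pickle_inv i) => [u|]//.
  case: asboolP => // Du; exfalso; apply: iD; apply/mem_set; exists u => //.
  by have := @pickle_invK (seq nat) i; rewrite E.
rewrite esum_image; last by move=> u v _ _; exact: (pcan_inj pickleK).
apply: le_esum => u Du; rewrite /fam_term Gu// lee_fin ler_expR.
have := sup_birk_le T osc (size u) (cylinder_point u) epos ee0.
rewrite mulrDl [eta * _]mulrC; lra.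
Qed.

(** Conversely, [e]-close points share their label, so a ball lies in the cylinder of the itinerary
    of its centre. *)
Lemma content_le_Mcov Z s N e : 0 < e -> e <= e0 ->
  (forall y z, l y = l z -> mdist y z < e0) ->
  (forall y z, mdist y z < e -> l y = l z) ->
  (content itinerary N (word_weight (s + eta)) Z <= Mcov T Z f s N e)%E.
Proof.
move=> epos ee0 le el; apply: le_ereal_inf_tmp => _ [G [GZ GN] <-].
pose phi i := if G i is Some (x, n) then mkseq (itinerary x) n else [::].
pose J := [set i | G i <> None].
have DZ : long_cover itinerary N (phi @` J) Z.
  split=> [z /GZ[i _]|_ [i Ji <-]].
    rewrite /fam_ball; case E : (G i) => [[x n]|//] /(BballP _ _ _ _ epos) xz.
    have phiE : phi i = mkseq (itinerary x) n by rewrite /phi E.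
    exists (phi i); first by exists i => //; rewrite /J /= E.
    rewrite phiE size_mkseq; apply/eq_in_map => j; rewrite mem_iota add0n /= => jn.
    by apply/esym; apply: el; exact: xz.
  by move: Ji; rewrite /J /phi /=; case E : (G i) => [[x n]|//] _; rewrite size_mkseq (GN _ _ _ E).
apply: (le_trans (content_le _ DZ)).
(* Several balls may give the same word; [psi] selects one index per word. *)
have /choice[psi Hpsi] u : exists i, (phi @` J) u -> J i /\ phi i = u.
  have [[i Ji iu]|] := pselect ((phi @` J) u); first by exists i.
  by exists 0%N.
rewrite (@eq_esum _ _ _ _ (fun u => word_weight (s + eta) (phi (psi u)))); last first.
  by move=> u /Hpsi[_ ->].
rewrite -(esum_image _ psi (fun i => word_weight (s + eta) (phi i))); last first.
  move=> u v /set_mem Du /set_mem Dv uv.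
  by rewrite -(Hpsi u Du).2 uv (Hpsi v Dv).2.
rewrite nneseries_esumT; last by move=> i; exact: fam_term_ge0.
rewrite esum_mkcond; apply: le_esum => i _.
case: ifPn => [/set_mem[u /Hpsi[Ji _] ui]|_]; last exact: fam_term_ge0.
rewrite ui /J /= in Ji; rewrite /fam_term.
case E : (G i) Ji => [[x n]|//] _.
have phiE : phi i = mkseq (itinerary x) n by rewrite /phi E.
have sphi : size (phi i) = n by rewrite phiE size_mkseq.
have xphi : mkseq (itinerary x) (size (phi i)) = phi i by rewrite sphi phiE.
rewrite /word_weight sphi lee_fin ler_expR.
have := birk_le_sup_center T osc n x epos ee0.
have : birk f T n (cylinder_point (phi i)) <= birk f T n x + n%:R * eta.
  apply: (birk_osc osc) => j jn; apply: le.
  by apply/esym; apply: cylinder_pointP => //; rewrite sphi.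
rewrite mulrDl [eta * _]mulrC; lra.
Qed.

End Itineraries.

(** * Approximation of the pressure by compact subsets *)

Lemma lte_dense {R : realType} (x y : \bar R) : (x < y)%E ->
  exists2 t : R, (x < t%:E)%E & (t%:E < y)%E.
Proof.
case: x => [x| |]; case: y => [y| |] //.
- by rewrite lte_fin => /midf_lt[xm my]; exists ((x + y) / 2); rewrite lte_fin.
- by move=> _; exists (x + 1); rewrite ?ltry// lte_fin ltrDl.
- by move=> _; exists (y - 1); rewrite ?ltNyr// lte_fin gtrBl.
- by move=> _; exists 0; rewrite ?ltry ?ltNyr.
Qed.

(** Ensures that the [lim] in [PB] is a genuine limit. *)
Lemma PBeps_cvg {R : realType} {X : metricType R} (T : X -> X) (f : X -> R)
    (Z : set X) :
  compact [set: X] -> continuous f -> cvg (PBeps T f Z e @[e --> 0^'+]).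
Proof.
move=> Xcpt fcont; apply: almost_monotone_cvg => eta eta0.
have [e e0 osc] := uniform_osc Xcpt fcont eta0.
by exists e => // x y x0 xy ye; exact: PBeps_radius osc _ _ _ _ _ _.
Qed.

Lemma continuous_iter {X : topologicalType} (T : X -> X) n :
  continuous T -> continuous (iter n T).
Proof.
move=> Tcont; elim: n => [x|n IH x]; first exact: cvg_id.
by apply: (@continuous_comp _ _ _ (iter n T) T); [exact: IH|exact: Tcont].
Qed.

Lemma itinerary_loc {R : realType} {X : metricType R} (T : X -> X) (l : X -> nat)
    (g : baire_space -> X) (x : baire_space) i :
  continuous T -> continuous g ->
  (forall x : X, exists2 A, nbhs x A & forall y z, A y -> A z -> l y = l z) ->
  \forall y \near x, itinerary T l (g y) i = itinerary T l (g x) i.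
Proof.
move=> Tcont gcont lloc.
have [A nA Al] := lloc (iter i T (g x)).
have : nbhs x ((iter i T \o g) @^-1` A).
  by apply: (continuous_comp (gcont x) (@continuous_iter _ T i Tcont (g x))).
by apply: filterS => y Ay; apply: Al => //; exact: nbhs_singleton.
Qed.

Lemma PB_compact_ge {R : realType} {X : metricType R} (T : X -> X) (f : X -> R)
    (Z : set X) (t eta : R) :
  compact [set: X] -> continuous T -> zero_dim X -> continuous f -> analytic Z ->
  (t%:E < PB T f Z)%E -> 0 < eta ->
  exists K : set X, [/\ K `<=` Z, compact K & ((t - eta)%:E <= PB T f K)%E].
Proof.
move=> Xcpt Tcont zX fcont [g [gcont gZ]] tP eta0.
(* One half of [eta] is spent in passing from balls to words, the other in returning to balls. *)
pose eta' := eta / 2; have eta'0 : 0 < eta' by rewrite divr_gt0.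
have [e0 e00 osc] := uniform_osc Xcpt fcont eta'0.
have [e [epos ee0 te]] : exists e, [/\ 0 < e, e <= e0 & (t%:E < PBeps T f Z e)%E].
  apply: contrapT => /forallNP H; move: tP; apply/negP; rewrite -leNgt.
  apply: lime_le; first exact: PBeps_cvg.
  near=> e; have epos : 0 < e by near: e; exact: nbhs_right_gt.
  have ee0 : e <= e0 by near: e; exact: nbhs_right_ltW.
  by rewrite leNgt; apply/negP => te; apply: (H e).
have [N MN] := PBeps_gt te.
have [l [ldist lloc]] := zero_dim_label Xcpt zX epos.
have [d d0 dl] := lebesgue_number Xcpt lloc.
pose x0 := g (fun=> 0%N).
pose W := word_weight T f l x0 (t - eta').
have cZ : (0 < content (itinerary T l) N W Z)%E.
  apply: lt_le_trans MN _.
  have := Mcov_le_content T x0 osc Z (t - eta') N epos ee0 ldist.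
  by rewrite subrK.
pose h x := itinerary T l (g x).
have W0 : forall u, (0 <= W u)%E by move=> u; exact: word_weight_ge0.
have cB : (0 < content h N W [set: baire_space])%E.
  apply: lt_le_trans cZ _; apply: le_ereal_inf_tmp => _ [D [DT DN] <-].
  apply: content_le; split => // z; rewrite -gZ => -[x _ <-].
  exact: DT.
(* The content may be infinite, so a real level [c] below it is fixed. *)
have [c c0 cc] : exists2 c : R, 0 < c & (c%:E < content h N W [set: baire_space])%E.
  move: cB; case: content => [r|_|//]; last by exists 1 => //; rewrite ltry.
  rewrite lte_fin => r0; exists (r / 2); first by rewrite divr_gt0.
  by rewrite lte_fin ltr_pdivrMr// ltr_pMr// ltr1n.
have [n cn] := content_box W0 (fun x i => itinerary_loc x i Tcont gcont lloc) cc.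
pose K := g @` [set x | forall i, (x i <= n i)%N].
have KZ : K `<=` Z by move=> _ [x _ <-]; rewrite -gZ; exists x.
have Kcpt : compact K.
  apply: (continuous_compact (continuous_subspaceT gcont)).
  exact: compact_baire_box.
have cK : (c%:E <= content (itinerary T l) N W K)%E.
  apply: le_trans cn _; apply: le_ereal_inf_tmp => _ [D [DK DN] <-].
  by apply: content_le; split => // x xn; apply: DK; exists x.
exists K; split => //; apply: lime_ge; first exact: PBeps_cvg.
(* [N], [c] and the labels do not depend on [r], so the bound holds for all small radii and passes
   to the limit. *)
near=> r.
have r0 : 0 < r by near: r; exact: nbhs_right_gt.
have rd : r <= d by near: r; exact: nbhs_right_ltW.
have re0 : r <= e0 by near: r; exact: nbhs_right_ltW.
apply: (@PBeps_ge _ _ _ _ _ _ N); apply: (@lt_le_trans _ _ c%:E); first by rewrite lte_fin.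
apply: le_trans cK _.
have -> : W = word_weight T f l x0 (t - eta + eta').
  by rewrite /W; congr word_weight; rewrite /eta' {2}(splitr eta) opprD addrA subrK.
apply: (content_le_Mcov T x0 osc) => //.
- by move=> y z /ldist yz; exact: lt_le_trans yz ee0.
- by move=> y z yz; apply: dl; exact: lt_le_trans yz rd.
Unshelve. all: by end_near. Qed.

Theorem theorem3p5 (R : realType) (X : metricType R) (T : X -> X) (f : X -> R)
  (Z : set X) :
  compact [set: X] -> continuous T -> zero_dim X -> continuous f ->
  analytic Z ->
  PB T f Z = ereal_sup [set PB T f K | K in [set K | K `<=` Z /\ compact K]].
Proof.
move=> Xcpt Tcont zX fcont Zan; apply/eqP; rewrite eq_le; apply/andP; split.
  set S := ereal_sup _; rewrite leNgt; apply/negP => SP.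
  have [t St tP] := lte_dense SP.
  move: St; apply/negP; rewrite -leNgt; apply/lee_subgt0Pr => eta eta0.
  have [K [KZ Kcpt tK]] := PB_compact_ge Xcpt Tcont zX fcont Zan tP eta0.
  by apply: le_trans tK _; apply: ereal_sup_ubound; exists K.
apply: ge_ereal_sup => _ [K [KZ _] <-]; apply: lee_lim; try exact: PBeps_cvg.
by apply: nearW => e; exact: PBeps_subset.
Qed.
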